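(* Let $k,n,r$ be positive integers with $r\ge 2$ and $n\geq rk$. If $n\not\equiv k \pmod{r-1}$ or $r$ is an even integer, then $$\chi(\mathrm{KG}^r(n,k)_{2\text{-}stab})=\left\lceil\frac{n-r(k-1)}{r-1}\right\rceil.$$
   Context: A subset $S\subseteq[n]=\{1,\ldots,n\}$ is $2$-stable if $2\le|i-j|\le n-2$ for all distinct $i,j\in S$. The hypergraph $\mathrm{KG}^r(n,k)_{2\text{-}stab}$ has as vertices all $2$-stable $k$-element subsets of $[n]$, and its edges are all $r$-element collections of pairwise disjoint vertices. The chromatic number $\chi$ of a hypergraph is the least number of colors in a coloring of its vertices such that no edge is monochromatic. *)

(* Defs.v *)
From mathcomp Require Import all_boot all_order all_algebra.

Set Implicit Arguments.
Unset Strict Implicit.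
Unset Printing Implicit Defensive.

Import Order.TTheory GRing.Theory Num.Theory.

(* A finite hypergraph is given by its vertex type [V : finType] and its edge
   set [E : {set {set V}}]. *)
Section Coloring.
Variable V : finType.
Implicit Types (E : {set {set V}}) (e : {set V}).

Definition monochromatic (c : nat) (f : {ffun V -> 'I_c}) e : bool :=
  [forall u in e, forall v in e, f u == f v].

Definition proper_coloring E (c : nat) (f : {ffun V -> 'I_c}) : bool :=
  [forall e in E, ~~ monochromatic f e].

Definition colorable E (c : nat) : bool :=
  [exists f : {ffun V -> 'I_c}, proper_coloring E f].

(* The least c with a proper c-coloring.  Searching up to #|V| is enough when
   every edge has at least two vertices (see chromatic_numberP); otherwise no
   proper coloring exists and the value #|V|.+1 has no meaning. *)
Definition chromatic_number E : nat := find (colorable E) (iota 0 #|V|.+1).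

Lemma chromatic_numberP E : (forall e, e \in E -> 1 < #|e|) ->
  colorable E (chromatic_number E) /\
  forall c, colorable E c -> chromatic_number E <= c.
Proof.
move=> E2; have colV : colorable E #|V|.
  apply/existsP; exists [ffun v => enum_rank v].
  apply/forall_inP => e /E2 /card_gt1P[u [v [ue ve nuv]]].
  apply/negP => /forall_inP/(_ u ue)/forall_inP/(_ v ve).
  by rewrite !ffunE (inj_eq enum_rank_inj) (negPf nuv).
have hasE : has (colorable E) (iota 0 #|V|.+1).
  by apply/hasP; exists #|V|; rewrite // mem_iota ltnSn.
have lt_chi : chromatic_number E < #|V|.+1.
  by rewrite /chromatic_number -{2}(size_iota 0 #|V|.+1) -has_find.
split; first by have := nth_find 0 hasE; rewrite nth_iota.
move=> c colc; rewrite leqNgt; apply/negP => ltc.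
have := before_find 0 ltc.
by rewrite nth_iota ?add0n ?colc // (ltn_trans ltc lt_chi).
Qed.

End Coloring.

(* [n] = {1, ..., n} is represented by 'I_n = {0, ..., n-1}; stability only
   involves differences of elements, hence is unaffected by the shift. *)
Definition two_stable (n : nat) (S : {set 'I_n}) : bool :=
  [forall i in S, forall j in S,
     (i != j) ==> (2 <= `|(i%:Z - j%:Z)%R|%N <= n - 2)].

Definition KG_vertex (n k : nat) : finType :=
  {S : {set 'I_n} | two_stable S && (#|S| == k)}.

Definition KG_edges (r n k : nat) : {set {set KG_vertex n k}} :=
  [set e : {set KG_vertex n k} | (#|e| == r) &&
     [forall A in e, forall B in e, (A != B) ==> [disjoint val A & val B]]].

Lemma KG_edges_card_gt1 r n k : 2 <= r ->
  forall e, e \in KG_edges r n k -> 1 < #|e|.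
Proof. by move=> r2 e; rewrite inE => /andP[/eqP-> _]. Qed.

(* Main.v *)
Require Import Defs.
From mathcomp Require Import all_boot all_order all_algebra.
From mathcomp Require Import ring zify.
Set Implicit Arguments.
Unset Strict Implicit.
Unset Printing Implicit Defensive.
Import Order.TTheory GRing.Theory Num.Theory.

(** The upper bound is the standard colouring: a vertex with minimum [m]
    (counted from 0) gets colour [m %/ (r - 1)], truncated at the last colour.
    Below the last colour, [r] disjoint vertices would have [r] distinct minima
    in a window of length [r - 1]; in the last colour they would not fit in the
    positions that remain ([colorable_upper]).

    The lower bound is topological.  A sign vector assigns to each of the [n]
    positions a sign in [Z/p] or nothing.  If no colour appeared on [p]
    disjoint vertices, every sign vector [X] would get a label (sign, rank):
    when the word of its nonzero signs has few runs, the rank is the number of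
    runs and the sign is the first one; otherwise the rank counts the pairs
    (sign [s], colour [c]) such that the fibre of [X] over [s] contains a vertex
    coloured [c], and the sign is an equivariant average, which exists because
    [p] is prime and no colour sees all [p] signs ([no_full_absurd]).  Rotating
    all signs rotates the label sign; extending [X] cannot decrease the rank,
    and preserves the sign when the rank stays the same.  Geometrically this
    is an equivariant map from the [n]-fold join of [Z/p] to an [M]-fold join,
    [M] being the number of ranks, so [n <= M] ([monotone_Zp_Tucker]), which
    the size of [n] excludes.

    Two kinds of stable sets feed this argument.  For any prime [p], more than
    [p * (k - 1)] runs force some fibre to contain a [k]-set without two
    consecutive positions.  For [p = 2], [2 * k] runs force both fibres to
    contain a [k]-set that is stable around the circle: along [2 * k]
    alternating positions, the first and the last carry different signs.  Here
    two pairs are present as soon as any is, and the rank saved is exactly what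
    turns path stability into cyclic stability.

    Composite [r] is reached by iterating: [r1] disjoint vertices of one colour
    inside each large enough set colour these sets, and [r2] disjoint large
    sets of one colour yield [r2 * r1] vertices ([Kneser_bound_mul]).  Only the
    outer step has to produce stable sets; for path stability [r2] is any prime
    factor of [r].  If [r] is even, the outer step is the cyclic case
    [r2 = 2].  If [n <> k %[mod r - 1]], the ceiling does not
    change when [n] is replaced by [n - 1], and a path-stable subset of the
    first [n - 1] positions is stable in the circle of length [n]
    ([two_stable_matching]). *)

(** * Cochains on sequences *)

Section Cochains.
Variable R : comPzRingType.
Local Open Scope ring_scope.

(** The coboundary of the augmented complex of ordered simplices. *)
Fixpoint cobd (T : Type) (f : seq T -> R) (l : seq T) : R :=
  if l is x :: l' then f l' - cobd (fun m => f (x :: m)) l' else 0.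

(** The prism operator of the homotopy from the identity to the vertex map [a]. *)
Fixpoint prism (T : Type) (a : T -> T) (f : seq T -> R) (l : seq T) : R :=
  if l is x :: l' then
    f [:: x, a x & map a l'] - prism a (fun m => f (x :: m)) l'
  else 0.

Lemma eq_cobd T (f g : seq T -> R) : f =1 g -> cobd f =1 cobd g.
Proof.
move=> fg l; elim: l f g fg => //= x l IHl f g fg.
by rewrite fg; congr (_ - _); apply: IHl => m; apply: fg.
Qed.

Lemma cobd0 T l : cobd (fun _ : seq T => 0) l = 0.
Proof. by elim: l => //= x l ->; rewrite subrr. Qed.

Lemma cobdB T (f g : seq T -> R) l :
  cobd (fun m => f m - g m) l = cobd f l - cobd g l.
Proof.
elim: l f g => /= [|x l IHl] f g; first by rewrite subrr.
by rewrite IHl !opprB; ring.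
Qed.

Lemma cobd_sum T (I : finType) (F : I -> seq T -> R) l :
  cobd (fun m => \sum_i F i m) l = \sum_i cobd (F i) l.
Proof.
elim: l F => /= [|x l IHl] F; first by rewrite big1.
by rewrite IHl sumrB.
Qed.

Lemma cobd_map T U (h : T -> U) (f : seq U -> R) l :
  cobd (fun m => f (map h m)) l = cobd f (map h l).
Proof. by elim: l f => //= x l IHl f; rewrite -IHl. Qed.

Lemma cobdK T (f : seq T -> R) l : cobd (cobd f) l = 0.
Proof.
elim: l f => //= x l IHl f.
by rewrite cobdB IHl subr0 subrr.
Qed.

Lemma prismB T (a : T -> T) (f g : seq T -> R) l :
  prism a (fun m => f m - g m) l = prism a f l - prism a g l.
Proof.
elim: l f g => /= [|x l IHl] f g; first by rewrite subrr.
by rewrite IHl !opprB; ring.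
Qed.

Lemma prism_homotopy T (a : T -> T) (f : seq T -> R) l :
  cobd (prism a f) l + prism a (cobd f) l = f (map a l) - f l.
Proof.
elim: l f => /= [|x l IHl] f; first by rewrite addr0 subrr.
rewrite cobdB prismB (cobd_map a (fun m => f [:: x, a x & m])).
have -> : prism a (cobd (fun m => f (x :: m))) l =
  f (x :: map a l) - f (x :: l) - cobd (prism a (fun m => f (x :: m))) l.
  by rewrite -(IHl (fun m => f (x :: m))); ring.
ring.
Qed.
End Cochains.

(** * Universal cochains of the cyclic group *)

Section Equivariant.
Local Open Scope ring_scope.
Variables (p : nat) (T : Type) (act : 'F_p -> T -> T).
Hypothesis actD : forall a b x, act a (act b x) = act (a + b) x.

Definition translate (a : 'F_p) : seq T -> seq T := map (act a).

Lemma translateD a b l : translate a (translate b l) = translate (a + b) l.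
Proof. by rewrite /translate -map_comp; apply: eq_map => x /=; apply: actD. Qed.

(** The two maps of the periodic resolution of the cyclic group: the norm, and
    the difference of a generator and the identity. *)
Definition orbit_sum (f : seq T -> 'F_p) l := \sum_a f (translate a l).
Definition increment (f : seq T -> 'F_p) l := f (translate 1 l) - f l.

(** At index 0 the identity, which stands for the augmentation; it is the only
    place where consecutive operators do not compose to 0. *)
Definition periodic_op i : (seq T -> 'F_p) -> seq T -> 'F_p :=
  if i is 0%N then id else if odd i then orbit_sum else increment.

Lemma eq_periodic_op i f g l : (forall a, f (translate a l) = g (translate a l)) ->
  f l = g l -> periodic_op i f l = periodic_op i g l.
Proof.
case: i => //= i fg fgl; case: ifP => _; rewrite /increment ?fg ?fgl //.
exact: eq_bigr.
Qed.

Lemma orbit_sum_increment f l : orbit_sum (increment f) l = 0.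
Proof.
rewrite /orbit_sum /increment sumrB [X in _ - X](reindex_inj (addrI 1)) /=.
by apply/eqP; rewrite subr_eq0; apply/eqP/eq_bigr => a _; rewrite translateD.
Qed.

Lemma increment_orbit_sum f l : increment (orbit_sum f) l = 0.
Proof.
rewrite /orbit_sum /increment [X in _ - X](reindex_inj (addIr 1)) /=.
by apply/eqP; rewrite subr_eq0; apply/eqP/eq_bigr => a _; rewrite translateD.
Qed.

Lemma periodic_opK i f l : periodic_op i.+1 (periodic_op i.+2 f) l = 0.
Proof.
rewrite /=; case: (odd i) => /=; first exact: increment_orbit_sum.
exact: orbit_sum_increment.
Qed.

Lemma cobd_periodic_op i f l : cobd (periodic_op i f) l = periodic_op i (cobd f) l.
Proof.
case: i => //= i; case: ifP => _.
  rewrite /orbit_sum cobd_sum; apply: eq_bigr => a _; exact: cobd_map.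
by rewrite /increment cobdB (cobd_map (act 1)).
Qed.

Lemma periodic_opB i f g l :
  periodic_op i (fun m => f m - g m) l = periodic_op i f l - periodic_op i g l.
Proof.
case: i => //= i; case: ifP => _; first by rewrite -sumrB.
by rewrite /increment; ring.
Qed.

Lemma periodic_op0 i l : periodic_op i (fun=> 0) l = 0.
Proof.
case: i => //= i; case: ifP => _; first by rewrite /orbit_sum big1.
by rewrite /increment subrr.
Qed.

End Equivariant.

Section Universal.
Local Open Scope ring_scope.
Variable p : nat.
Notation F := 'F_p.
Implicit Types (f : seq F -> F) (l : seq F).

Notation tr := (translate (@GRing.add F)).
Local Lemma trD a b l : tr a (tr b l) = tr (a + b) l.
Proof. by apply: translateD => *; rewrite addrA. Qed.
Local Lemma tr0 l : tr 0 l = l.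
Proof. by rewrite /translate (eq_map (g := id)) ?map_id // => x; rewrite add0r. Qed.

Lemma invariant_tr f : (forall l, increment +%R f l = 0) ->
  forall a l, f (tr a l) = f l.
Proof.
move=> f1 a l; rewrite -(natr_Zp a); elim: (val a) => [|m IHm]; first by rewrite tr0.
have /eqP := f1 (tr m%:R l).
by rewrite subr_eq0 IHm trD addrC natr1 => /eqP.
Qed.

(** A fundamental domain for the translations of nonempty sequences.  The
    default value 1 of [head] puts [::] outside it. *)
Definition leading0 l : F := (head 1 l == 0)%:R.

Lemma leading0_sum x l : \sum_a leading0 (tr a (x :: l)) = 1.
Proof.
rewrite (bigD1 (- x)) //= big1 => [|a neq]; rewrite /leading0 /= ?addNr ?eqxx ?addr0 //.
by rewrite addr_eq0 (negPf neq).
Qed.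

(** Summing over an orbit the part of an invariant function that is supported on
    the fundamental domain recovers the function. *)
Lemma orbit_sum_section f : f [::] = 0 -> (forall l, increment +%R f l = 0) ->
  forall l, orbit_sum +%R (fun m => leading0 m * f m) l = f l.
Proof.
move=> f0 finv [|x l].
  by rewrite /orbit_sum big1 // => a _; rewrite /= f0 mulr0.
rewrite -[RHS]mul1r -(leading0_sum x l) mulr_suml; apply: eq_bigr => a _.
by rewrite (invariant_tr finv).
Qed.

(** The part of [f] on the translate by [- b] of the fundamental domain is moved
    into the domain, and [1 + g + .. + g ^+ (b - 1)] is applied to it, [g] being
    the translation by 1; as [g - 1] times this sum is [g ^+ b - 1], [increment]
    puts it back in place, up to an error supported in the domain. *)
Definition increment_section f l : F :=
  \sum_(b : F) \sum_(j < val b)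
     leading0 (tr j%:R l) * f (tr (j%:R - b) l).

(** The errors add up to the part of [orbit_sum f] in the fundamental domain. *)
Lemma increment_sectionP f : f [::] = 0 -> (forall l, orbit_sum +%R f l = 0) ->
  forall l, increment +%R (increment_section f) l = f l.
Proof.
move=> f0 fN [|x l].
  have z : increment_section f [::] = 0.
    by apply: big1 => b _; apply: big1 => j _; rewrite /= f0 mulr0.
  by rewrite /increment /= z subrr f0.
set m := x :: l.
rewrite /increment /increment_section -sumrB.
transitivity (\sum_(b : F) (leading0 (tr b m) * f m - leading0 m * f (tr (- b) m))).
  apply: eq_bigr => b _.
  pose h j := leading0 (tr j%:R m) * f (tr (j%:R - b) m).
  transitivity (h (val b) - h 0%N).
    rewrite -(telescope_sumr h (leq0n _)) big_mkord -sumrB; apply: eq_bigr => j _.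
    by rewrite /h !trD -natr1 addrAC.
  by rewrite /h natr_Zp subrr !tr0 sub0r.
rewrite sumrB -mulr_suml leading0_sum mul1r -mulr_sumr.
rewrite (reindex_inj oppr_inj) /=.
under eq_bigr do rewrite opprK.
by have := fN m; rewrite /orbit_sum => ->; rewrite mulr0 subr0.
Qed.

(** Cochains lifting the augmentation through the periodic resolution; each is
    obtained from the coboundary of its predecessor by an explicit section of
    [orbit_sum] or [increment], available because that coboundary is killed by
    the other operator. *)
Fixpoint universal_cochain i : seq F -> F :=
  if i is i'.+1 then
    if odd i then fun l => leading0 l * cobd (universal_cochain i') l
    else increment_section (cobd (universal_cochain i'))
  else fun l => (nilp l)%:R.

Lemma cobd_universal_cochain i l :
  cobd (universal_cochain i) l =
  periodic_op +%R i.+1 (universal_cochain i.+1) l.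
Proof.
elim: i l => [|i IHi] l.
  symmetry; apply: orbit_sum_section => // {}l.
  rewrite /increment -cobd_map -cobdB -[RHS](cobd0 'F_p l).
  by apply: eq_cobd => m; rewrite /= /nilp size_map subrr.
have IH2 m : periodic_op +%R i.+1 (cobd (universal_cochain i.+1)) m = 0.
  rewrite -cobd_periodic_op -[RHS](cobdK (universal_cochain i) m); apply: eq_cobd => {}m.
  by rewrite IHi.
move: IH2; rewrite /= -/universal_cochain; case: (odd i) => /= IH2; symmetry.
  exact: orbit_sum_section.
exact: increment_sectionP.
Qed.

Definition normalized f := forall l x r, f (l ++ [:: x, x & r]) = 0.

(** The two deletions inside the repeated pair cancel, the others keep it. *)
Lemma cobd_normalized f : normalized f -> normalized (cobd f).
Proof.
move=> nf l; elim: l f nf => [|y l IHl] f nf x r /=.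
  rewrite opprB addrCA subrr addr0.
  by rewrite (@eq_cobd _ _ _ (fun=> 0)) ?cobd0 // => m; apply: (nf [::]).
by rewrite nf IHl ?subrr // => m *; apply: (nf (y :: m)).
Qed.

Lemma universal_cochain_normalized i : normalized (universal_cochain i).
Proof.
elim: i => [|i IHi] l x r; first by case: l.
have nc := cobd_normalized IHi.
rewrite /=; case: ifP => _; first by rewrite nc mulr0.
apply: big1 => b _; apply: big1 => j _.
by rewrite /translate !map_cat nc mulr0.
Qed.
End Universal.

(** * Sign vectors and a monotone Tucker lemma *)

Section SignVectors.
Local Open Scope ring_scope.
Variables (p n : nat).

Definition signvec := {ffun 'I_n -> option 'F_p}.
Implicit Types X Y Z : signvec.

Definition rotate (a : 'F_p) X : signvec := [ffun i => omap (+%R a) (X i)].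
Definition extended X Y := [forall i, (X i == None) || (X i == Y i)].
Definition nonzero X := [exists i, X i != None].
Definition below j X := [forall i : 'I_n, (X i != None) ==> (i < j)%N].
Definition unitvec (j : nat) : signvec :=
  [ffun i : 'I_n => if i == j :> nat then Some 0 else None].
Definition addcoord j X : signvec :=
  [ffun i : 'I_n => if i == j :> nat then Some 0 else X i].

Lemma rotateD a b X : rotate a (rotate b X) = rotate (a + b) X.
Proof. by apply/ffunP => i; rewrite !ffunE; case: (X i) => //= x; rewrite addrA. Qed.

Lemma extended_trans : transitive extended.
Proof.
move=> Y X Z /forallP XY /forallP YZ; apply/forallP => i.
by case/orP: (XY i) => [->//|/eqP->]; apply: YZ.
Qed.

Lemma extended_rotate a X Y : extended X Y -> extended (rotate a X) (rotate a Y).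
Proof.
move=> /forallP XY; apply/forallP => i; rewrite !ffunE.
by case/orP: (XY i) => /eqP->; rewrite ?eqxx ?orbT //=.
Qed.

Lemma extended_addcoord j X : below j X -> extended X (addcoord j X).
Proof.
move=> /forallP bX; apply/forallP => i; rewrite ffunE.
case: ifP => [/eqP E|_]; last by rewrite eqxx orbT.
by have := bX i; rewrite E ltnn implybF negbK => /eqP->.
Qed.

Lemma addcoord_extended j X Y : extended X Y -> extended (addcoord j X) (addcoord j Y).
Proof.
move=> /forallP XY; apply/forallP => i; rewrite !ffunE.
by case: ifP => _; [rewrite orbT | apply: XY].
Qed.

Lemma extended_unitvec j X : extended (unitvec j) (addcoord j X).
Proof. by apply/forallP => i; rewrite !ffunE; case: ifP. Qed.

Lemma nonzero_rotate a X : nonzero (rotate a X) = nonzero X.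
Proof. by apply: eq_existsb => i; rewrite ffunE; case: (X i). Qed.

Lemma below_rotate a j X : below j (rotate a X) = below j X.
Proof. by apply: eq_forallb => i; rewrite ffunE; case: (X i). Qed.

Lemma nonzero_addcoord j X : nonzero X -> nonzero (addcoord j X).
Proof. by case/existsP => i Xi; apply/existsP; exists i; rewrite ffunE; case: ifP. Qed.

Lemma below_addcoord j X : below j X -> below j.+1 (addcoord j X).
Proof.
move/forallP=> bX; apply/forallP => i; rewrite ffunE ltnS.
case: ifP => [/eqP->|_]; first by rewrite leqnn implybT.
by apply/implyP => Xi; apply: ltnW; apply: (implyP (bX i)).
Qed.

Lemma belowW j X : below j X -> below j.+1 X.
Proof.
move/forallP=> bX; apply/forallP => i; apply/implyP => Xi.
exact: ltnW (implyP (bX i) Xi).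
Qed.

Lemma nonzero_unitvec j : (j < n)%N -> nonzero (unitvec j).
Proof. by move=> jn; apply/existsP; exists (Ordinal jn); rewrite ffunE eqxx. Qed.

Lemma below_unitvec j : below j.+1 (unitvec j).
Proof. by apply/forallP => i; rewrite ffunE; case: ifP => // /eqP->; rewrite ltnSn. Qed.

(** The sequences at which a cochain gets evaluated when its pairing with the
    fundamental chain, [evaluate] below, is expanded. *)
Definition flag j (l : seq signvec) :=
  [&& size l == j, pairwise extended l & all (fun X => nonzero X && below j X) l].

Lemma flag_translate a j l : flag j l -> flag j (translate rotate a l).
Proof.
rewrite {1}/flag => /and3P[sl pl al]; rewrite /flag size_map sl /=.
apply/andP; split.
  rewrite pairwise_map; apply: sub_pairwise pl => X Y; exact: extended_rotate.
by rewrite all_map (eq_all (a2 := fun X => nonzero X && below j X)) // => X /=;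
  rewrite nonzero_rotate below_rotate.
Qed.

Lemma flag_cone j l : (j < n)%N -> flag j l ->
  flag j.+1 (unitvec j :: map (addcoord j) l).
Proof.
move=> jn /and3P[/eqP sl pl al]; rewrite /flag /= size_map sl eqxx.
rewrite nonzero_unitvec // below_unitvec !all_map pairwise_map /= -andbA.
apply/and3P; split.
- by apply/allP => X _ /=; apply: extended_unitvec.
- by apply: sub_pairwise pl => X Y; apply: addcoord_extended.
apply: sub_all al => X /andP[nX bX] /=.
by rewrite nonzero_addcoord // below_addcoord.
Qed.

Lemma flag_prism j l X r : flag j (l ++ X :: r) ->
  flag j.+1 (l ++ [:: X, addcoord j X & map (addcoord j) r]).
Proof.
rewrite /flag !size_cat /= size_map !pairwise_cat !allrel_consr !all_cat /=.
rewrite !all_map !pairwise_map allrel_mapr.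
case/and3P=> /eqP sl /and3P[/andP[lX lr] pl /andP[Xr pr]].
case/and3P=> al /andP[nX bX] ar; rewrite lX pl /=.
have -> : (size l + (size r).+2)%N == j.+1 by rewrite addnS sl.
have X_aX := extended_addcoord bX.
have sub_a Y Z : below j Z -> extended Y Z -> extended Y (addcoord j Z).
  by move=> bZ YZ; apply: extended_trans YZ (extended_addcoord bZ).
have br Z : Z \in r -> below j Z by move/(allP ar)/andP=> [].
rewrite nX (belowW bX) X_aX nonzero_addcoord // below_addcoord //=.
repeat (apply/andP; split).
- by apply: sub_all lX => Y /sub_a; apply.
- apply/allrelP => Y Z lY rZ; apply: sub_a (br _ rZ) _.
  by move/allrelP: lr; apply.
- by apply/allP => Z rZ /=; apply: sub_a (br _ rZ) (allP Xr _ rZ).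
- by apply: sub_all Xr => Z; apply: addcoord_extended.
- by apply: sub_pairwise pr => Y Z; apply: addcoord_extended.
- by apply: sub_all al => Y /andP[-> /belowW].
by apply: sub_all ar => Y /andP[nY bY] /=; rewrite nonzero_addcoord // below_addcoord.
Qed.

Implicit Types f g : seq signvec -> 'F_p.

(** The complex of vectors on the first [j] coordinates is contractible inside
    that of the first [j.+1]: every vector [X] is below [addcoord j X], which
    is above the vertex [unitvec j]. *)
Definition contraction j f l :=
  f (unitvec j :: map (addcoord j) l) - prism (addcoord j) f l.

Lemma contraction_homotopy j f l :
  contraction j (cobd f) l + cobd (contraction j f) l = f l.
Proof.
rewrite /contraction cobdB /= (cobd_map _ (fun m => f (unitvec j :: m))).
have := prism_homotopy (addcoord j) f l => /eqP.
by rewrite -subr_eq0 => /eqP E; rewrite -[RHS]subr0 -E; ring.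
Qed.

Lemma eq_prism_at (a : signvec -> signvec) f g l :
  (forall l1 x l2, l = l1 ++ x :: l2 ->
     f (l1 ++ [:: x, a x & map a l2]) = g (l1 ++ [:: x, a x & map a l2])) ->
  prism a f l = prism a g l.
Proof.
elim: l f g => //= x l IHl f g fg; rewrite (fg [::] x l) //; congr (_ - _).
by apply: IHl => l1 y l2 E; apply: (fg (x :: l1)); rewrite E.
Qed.

(** Pairing with the fundamental chain in the join of [j] copies of [Z/p], which
    is never written down: its boundary is a [periodic_op] image of the previous
    chain, and it is the cone on it given by the contraction. *)
Fixpoint evaluate j f : 'F_p :=
  if j is j'.+1 then evaluate j' (periodic_op rotate j' (contraction j' f))
  else f [::].

Lemma eq_evaluate j f g : (j <= n)%N -> (forall l, flag j l -> f l = g l) ->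
  evaluate j f = evaluate j g.
Proof.
elim: j f g => [|j IHj] f g jn fg /=; first exact: fg.
have Efg m : flag j m -> contraction j f m = contraction j g m.
  move=> gm; rewrite /contraction fg ?flag_cone //; congr (_ - _).
  by apply: eq_prism_at => l1 x l2 E; apply/fg/flag_prism; rewrite -E.
apply: IHj => [|l gl]; first exact: ltnW.
by apply: eq_periodic_op => [a|]; apply: Efg; rewrite // flag_translate.
Qed.

Lemma evaluateB j f g : (j <= n)%N ->
  evaluate j (fun l => f l - g l) = evaluate j f - evaluate j g.
Proof.
elim: j f g => //= j IHj f g jn; rewrite -IHj ?(ltnW jn) //.
have E l : contraction j (fun m => f m - g m) l = contraction j f l - contraction j g l.
  by rewrite /contraction prismB; ring.
apply: eq_evaluate (ltnW jn) _ => l _; rewrite -periodic_opB.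
by apply: eq_periodic_op => // a; apply: E.
Qed.

Lemma evaluate0 j : (j <= n)%N -> evaluate j (fun=> 0) = 0.
Proof.
move=> jn; rewrite -[RHS](subrr (evaluate j (fun=> 0))) -evaluateB //.
by apply: eq_evaluate => // l _; rewrite subrr.
Qed.

Hypothesis p_pr : prime p.

(** Stokes' formula.  The error term composes two consecutive operators; it
    vanishes by [periodic_opK], except at [j = 1], where the identity and the
    orbit sum compose to a sum of [p] equal terms, which is 0 in
    characteristic [p]. *)
Lemma evaluate_cobd j f : (j < n)%N ->
  evaluate j.+1 (cobd f) = evaluate j (periodic_op rotate j f).
Proof.
elim: j f => [|j IHj] f jn.
  by rewrite /= -[RHS](contraction_homotopy 0 f [::]) [cobd _ [::]]/= addr0.
rewrite [LHS]/=.
pose h := periodic_op rotate j.+1 (contraction j.+1 f).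
transitivity (evaluate j.+1 (fun l => periodic_op rotate j.+1 f l - cobd h l)).
  apply: eq_evaluate (ltnW jn) _ => l _; rewrite cobd_periodic_op -periodic_opB.
  have E m : contraction j.+1 (cobd f) m = f m - cobd (contraction j.+1 f) m.
    by rewrite -[in RHS](contraction_homotopy j.+1 f m) addrK.
  by apply: (@eq_periodic_op _ _ rotate j.+1) => // a; apply: E.
rewrite (evaluateB _ _ (ltnW jn)) (IHj h (ltnW jn)).
suff -> : evaluate j (periodic_op rotate j h) = 0 by rewrite subr0.
rewrite /h; case: j {IHj h} jn => [|j] jn.
  rewrite /= /orbit_sum /= sumr_const card_Fp // -mulr_natr.
  by have /eqP := pchar_Fp_0 p_pr => /eqP ->; rewrite mulr0.
rewrite -[RHS](@evaluate0 j.+1) 1?ltnW 1?ltnW //.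
by apply: eq_evaluate => [|l _]; [do 2 apply: ltnW | apply/periodic_opK/rotateD].
Qed.

Section Tucker.
Variables (M : nat) (sgn : signvec -> 'F_p) (rk : signvec -> nat).
Hypothesis sgn_rotate : forall a X, nonzero X -> sgn (rotate a X) = a + sgn X.
Hypothesis rk_lt : forall X, nonzero X -> (rk X < M)%N.
Hypothesis rk_mono : forall X Y, nonzero X -> extended X Y -> (rk X <= rk Y)%N.
Hypothesis rk_sgn : forall X Y, nonzero X -> extended X Y -> rk X = rk Y -> sgn X = sgn Y.

(** A long chain cannot have strictly increasing ranks, and a repeated rank is a
    repeated sign. *)
Lemma flag_sgn l b : pairwise extended l -> all nonzero l -> (b <= M)%N ->
  all (fun X => b <= rk X)%N l -> (M < b + size l)%N ->
  exists l1 x l2, map sgn l = l1 ++ [:: x, x & l2].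
Proof.
elim: l b => [|X [|Y l] IHl] b /=; first by lia.
  by move=> _ /andP[/rk_lt ? _] _ /andP[? _]; lia.
move=> /andP[/andP[XY Xl] /[dup] pYl /andP[Yl _]] /andP[nX nYl] bM /andP[bX _] Ml.
have [eXY|neXY] := eqVneq (rk X) (rk Y).
  by exists [::], (sgn X), (map sgn l); rewrite /= -(rk_sgn nX XY eXY).
have ltXY : (rk X < rk Y)%N by rewrite ltn_neqAle neXY rk_mono.
have [nY _] := andP nYl.
have [|||l1 [x [l2 E]]] := IHl (rk X).+1 pYl nYl; last first.
- by exists (sgn X :: l1), x, l2; rewrite -[sgn Y :: _]/(map sgn (Y :: l)) E.
- by rewrite /=; lia.
- rewrite /= ltXY /=; apply: sub_all Yl => Z YZ.
  exact: leq_trans ltXY (rk_mono nY YZ).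
exact: rk_lt.
Qed.

(** By Stokes, the value does not depend on [j]; at [j = 0] it is the
    augmentation of a point. *)
Lemma evaluate_universal_cochain j : (j <= n)%N ->
  evaluate j (periodic_op rotate j (fun l => universal_cochain j (map sgn l))) = 1.
Proof.
elim: j => [|j IHj] jn //; rewrite -[RHS](IHj (ltnW jn)) -(evaluate_cobd _ jn).
apply: eq_evaluate jn _ => l /and3P[_ _ al]; rewrite cobd_map cobd_universal_cochain.
have E a : map sgn (translate rotate a l) = translate +%R a (map sgn l).
  rewrite /translate -!map_comp; apply/eq_in_map => X /(allP al) /andP[nX _].
  exact: sgn_rotate.
rewrite /=; case: ifP => _; rewrite /increment ?E //.
by apply: eq_bigr => a _; rewrite E.
Qed.

(** The last universal cochain, once [periodic_op] is applied, has value 1 on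
    the fundamental chain; if [M < n], it vanishes on every flag, because it is
    normalized and [flag_sgn] gives a repeated sign. *)
Theorem monotone_Zp_Tucker : (n <= M)%N.
Proof.
rewrite leqNgt; apply/negP => Mn.
have := evaluate_universal_cochain (leqnn n); rewrite (@eq_evaluate _ _ (fun=> 0)) //.
  by rewrite evaluate0 // => /esym/eqP; rewrite oner_eq0.
move=> l gl; rewrite -[RHS](periodic_op0 rotate n l).
have E m : flag n m -> universal_cochain n (map sgn m) = 0.
  case/and3P=> /eqP sm pm am.
  have nm : all nonzero m by apply: sub_all am => X /andP[].
  have m0 : all (fun X => 0 <= rk X)%N m by apply/allP.
  have Mm : (M < 0 + size m)%N by rewrite sm.
  have [l1 [x [l2 ->]]] := flag_sgn pm nm (leq0n M) m0 Mm.
  exact: universal_cochain_normalized.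
by apply: eq_periodic_op => [a|]; apply: E; rewrite // flag_translate.
Qed.
End Tucker.
End SignVectors.

(** * Labelling sign vectors by runs and colours *)

Section Runs.
Variable T : eqType.

Fixpoint runs (l : seq T) : nat :=
  if l is x :: l' then (ohead l' != Some x) + runs l' else 0.

(** The additional term says that a new first letter always costs a run; it is
    why the first sign is constant along extensions with the same number of
    runs. *)
Lemma runs_subseq l m : subseq l m -> runs l + (ohead l != ohead m) <= runs m.
Proof.
elim: m l => [|y m IHm] [|x l] //= sub.
  by have := IHm [::] (sub0seq m); case: (m) => //= z m'; case: (_ == _) => /=; lia.
have [E|nxy] := eqVneq x y.
  move: sub; rewrite E eqxx => /IHm; rewrite eqxx addn0.
  have [->|nml] := eqVneq (ohead l) (ohead m); first by lia.
  have [Em|] := eqVneq (ohead m) (Some y); last by lia.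
  by rewrite -Em nml /=; lia.
move: sub; rewrite (negPf nxy) => /IHm /=.
have -> : (Some x != Some y) = true by apply: contra nxy => /eqP[->].
have [->|] := eqVneq (ohead m) (Some y); last by lia.
have -> : (Some x != Some y) = true by apply: contra nxy => /eqP[->].
lia.
Qed.

Lemma runs_map (h : T -> T) l : injective h -> runs (map h l) = runs l.
Proof.
move=> hI; elim: l => //= x l ->; congr (_ + _).
by case: l => //= y l; rewrite !(inj_eq Some_inj) (inj_eq hI).
Qed.

Lemma runs_gt0 l : l != [::] -> 0 < runs l.
Proof. by move=> l0; have := runs_subseq (sub0seq l); case: l l0. Qed.

(** One keeps the last entry of each run; the condition on first letters
    carries the induction. *)
Lemma alternating_subseq (U : eqType) (X : U -> option T) e : exists b : seq U,
  [/\ subseq b e, size b = runs (pmap X e), all (fun i => X i) b,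
      sorted (fun i j => X i != X j) b
    & ohead (pmap X b) = ohead (pmap X e)].
Proof.
elim: e => [|x e [b [sub sz Xb alt hd]]]; first by exists [::].
rewrite [pmap X (x :: e)]/=; case Xx : (X x) => [c|] /=; last first.
  by exists b; split=> //; apply: subseq_trans sub (subseq_cons _ _).
have [E|nE] := eqVneq (ohead (pmap X e)) (Some c).
  by exists b; split; rewrite // ?hd //; apply: subseq_trans sub (subseq_cons _ _).
exists (x :: b); split; rewrite /= ?eqxx ?sz ?Xx //.
case: b {sub sz} Xb alt hd => //= y b /andP[Xy _] alt hd.
rewrite alt andbT Xx; move: hd nE Xy; case: (X y) => //= d <-.
by rewrite eq_sym.
Qed.
End Runs.

Section Word.
Local Open Scope ring_scope.
Variables (p n : nat).
Implicit Types X Y : signvec p n.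

Definition word X : seq 'F_p := pmap X (enum 'I_n).

Lemma word_rotate a X : word (rotate a X) = map (+%R a) (word X).
Proof.
rewrite /word; elim: (enum _) => //= i e IHe.
by rewrite ffunE; case: (X i) => //= s; rewrite IHe.
Qed.

Lemma word_extended X Y : extended X Y -> subseq (word X) (word Y).
Proof.
move/forallP=> XY; rewrite /word; elim: (enum _) => //= i e IHe.
case/orP: (XY i) => /eqP->; last by case: (Y i) => //= s; rewrite eqxx.
by case: (Y i) => //= s; apply: subseq_trans IHe (subseq_cons _ _).
Qed.

Lemma word_nonzero X : nonzero X -> word X != [::].
Proof.
case/existsP=> i; case Xi : (X i) => [s|] // _.
have : s \in word X by rewrite mem_pmap; apply/mapP; exists i; rewrite ?mem_enum.
by case: (word X).
Qed.

Definition alternation X := runs (word X).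

Lemma alternation_rotate a X : alternation (rotate a X) = alternation X.
Proof. by rewrite /alternation word_rotate runs_map //; apply: addrI. Qed.

Lemma alternation_gt0 X : nonzero X -> (0 < alternation X)%N.
Proof. by move/word_nonzero/runs_gt0. Qed.

Definition fiber X s := [set i | X i == Some s].

Lemma fiber_rotate a X s : fiber (rotate a X) s = fiber X (s - a).
Proof.
apply/setP => i; rewrite !inE ffunE; case: (X i) => //= c.
by rewrite !(inj_eq Some_inj) [RHS]eq_sym subr_eq addrC eq_sym.
Qed.

Lemma fiber_extended X Y s : extended X Y -> fiber X s \subset fiber Y s.
Proof.
move/forallP=> XY; apply/subsetP => i; rewrite !inE => /eqP Xi.
by have := XY i; rewrite Xi /= eq_sym.
Qed.
End Word.

Section ColoredFibers.
Local Open Scope ring_scope.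
Variables (p n t a b : nat) (P : pred {set 'I_n}) (f : {set 'I_n} -> nat).
Hypothesis p_pr : prime p.
Hypothesis f_lt : forall S, P S -> (f S < t)%N.
Hypothesis b_gt0 : (0 < b)%N.
Hypothesis many : forall X : signvec p n, (a < alternation X)%N ->
  (b <= #|[set s | [exists S, P S && (S \subset fiber X s)]]|)%N.
Hypothesis n_gt : (a + (t * (p - 1) + 1 - b) < n)%N.

Implicit Types X Y : signvec p n.
Implicit Types A : {set 'F_p * 'I_t}.

Definition palette X : {set 'F_p * 'I_t} :=
  [set sc : 'F_p * 'I_t | [exists S : {set 'I_n},
     [&& P S, S \subset fiber X sc.1 & f S == sc.2 :> nat]]].

Definition slice A (c : 'I_t) : {set 'F_p} := [set s | (s, c) \in A].

Lemma in_slice A s c : (s \in slice A c) = ((s, c) \in A).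
Proof. by rewrite inE. Qed.

Lemma card_slices A : #|A| = (\sum_c #|slice A c|)%N.
Proof.
rewrite -sum1_card (eq_bigr (fun c => \sum_(s | (s, c) \in A) 1)%N); last first.
  by move=> c _; rewrite -sum1_card; apply: eq_bigl => s; rewrite inE.
rewrite (exchange_big_dep predT) //= pair_big_dep /=.
by apply: eq_bigl => -[s c].
Qed.

Lemma palette_rotate k X s c : ((s, c) \in palette (rotate k X)) = ((s - k, c) \in palette X).
Proof. by rewrite !inE; apply: eq_existsb => S; rewrite /= fiber_rotate. Qed.

Lemma card_slice_rotate k X c : #|slice (palette (rotate k X)) c| = #|slice (palette X) c|.
Proof.
have -> : slice (palette (rotate k X)) c = [set k + s | s in slice (palette X) c].
  apply/setP => s; rewrite inE palette_rotate; apply/idP/imsetP => [sk|[u]].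
    by exists (s - k); [rewrite inE | rewrite addrC subrK].
  by rewrite inE => uX ->; rewrite addrC addKr.
by rewrite card_imset //; apply: addrI.
Qed.

Lemma palette_extended X Y : extended X Y -> palette X \subset palette Y.
Proof.
move=> XY; apply/subsetP => -[s c]; rewrite !inE => /existsP[S /and3P[PS SX fS]].
apply/existsP; exists S; rewrite PS fS andbT /=.
exact: subset_trans SX (fiber_extended _ XY).
Qed.

(** Translating [B] by [k] translates [mean B] by [k], as soon as [#|B|] is
    nonzero modulo [p]. *)
Definition mean (B : {set 'F_p}) : 'F_p := (\sum_(s in B) s) / #|B|%:R.

Definition palette_sign A : 'F_p :=
  if [pick c | slice A c != set0] is Some c then mean (slice A c) else 0.

Definition full X c := slice (palette X) c == setT.

Hypothesis no_full : forall X c, ~~ full X c.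

Lemma card_slice_lt X c : (#|slice (palette X) c| < p)%N.
Proof.
rewrite -[X in (_ < X)%N](card_Fp p_pr) -cardsT; apply: proper_card.
by rewrite properT; apply: no_full.
Qed.

Lemma palette_sign_rotate k X : palette X != set0 ->
  palette_sign (palette (rotate k X)) = k + palette_sign (palette X).
Proof.
move=> X0; rewrite /palette_sign.
have E c : (slice (palette (rotate k X)) c != set0) = (slice (palette X) c != set0).
  by rewrite -!card_gt0 card_slice_rotate.
rewrite (eq_pick E); case: pickP => [c Xc|none]; last first.
  case/set0Pn: X0 => -[s c] sc; have /negbFE/eqP/setP/(_ s) := none c.
  by rewrite in_slice sc inE.
rewrite /mean card_slice_rotate.
have ne0 : #|slice (palette X) c|%:R != 0 :> 'F_p.
  rewrite -(dvdn_pcharf (pchar_Fp p_pr)) gtnNdvd ?card_gt0 //.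
  exact: card_slice_lt.
rewrite (reindex_inj (addrI k)) /=.
rewrite (eq_bigl (fun s => s \in slice (palette X) c)) => [|s]; last first.
  by rewrite !in_slice palette_rotate addrC addKr.
by rewrite big_split /= sumr_const mulrDl -[k *+ _]mulr_natr mulfK.
Qed.

Lemma card_palette_le X : (#|palette X| <= t * (p - 1))%N.
Proof.
rewrite card_slices -[X in (_ <= X * _)%N]card_ord -sum_nat_const leq_sum // => c _.
by have := card_slice_lt X c; lia.
Qed.

Lemma card_palette_ge X : (a < alternation X)%N -> (b <= #|palette X|)%N.
Proof.
move=> aX; apply: leq_trans (many aX) _.
apply: leq_trans (leq_imset_card fst (palette X)); apply: subset_leq_card.
apply/subsetP => s; rewrite inE => /existsP[S /andP[PS SX]].
apply/imsetP; exists (s, Ordinal (f_lt PS)) => //.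
by rewrite inE; apply/existsP; exists S; rewrite PS SX eqxx.
Qed.

(** The first branch takes the values below [a].  The second one starts at [a],
    because the palette then has at least [b] pairs, and it stays below
    [a + (t * (p - 1) + 1 - b)], because no colour has all [p] signs. *)
Definition label_rank X :=
  (if alternation X <= a then (alternation X).-1 else a + (#|palette X| - b))%N.

Definition label_sign X : 'F_p :=
  if (alternation X <= a)%N then head 0 (word X) else palette_sign (palette X).

(** The labels satisfy the assumptions of [monotone_Zp_Tucker] with
    fewer than [n] ranks. *)
Lemma no_full_absurd : False.
Proof.
suff : (n <= a + (t * (p - 1) + 1 - b))%N by rewrite leqNgt n_gt.
have alt_sub X Y : extended X Y ->
    (alternation X + (ohead (word X) != ohead (word Y)) <= alternation Y)%N.
  by move/word_extended/runs_subseq.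
apply: (@monotone_Zp_Tucker p n p_pr _ label_sign label_rank).
- move=> k X nX; rewrite /label_sign alternation_rotate; case: leqP => [_|aX].
    by rewrite word_rotate; have := word_nonzero nX; case: (word X).
  apply: palette_sign_rotate; rewrite -card_gt0.
  exact: leq_trans b_gt0 (card_palette_ge aX).
- move=> X nX; rewrite /label_rank; have := alternation_gt0 nX.
  case: (leqP _ a) => [|aX _]; first by lia.
  by have := card_palette_ge aX; have := card_palette_le X; lia.
- move=> X Y nX XY; rewrite /label_rank; have := alt_sub _ _ XY.
  have := alternation_gt0 nX.
  have := subset_leq_card (palette_extended XY).
  by case: (leqP _ a) => ?; case: (leqP _ a) => ?; lia.
move=> X Y nX XY; rewrite /label_rank /label_sign; have := alt_sub _ _ XY.
have := alternation_gt0 nX.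
have sub := palette_extended XY.
case: (leqP (alternation X) a) => aX; case: (leqP (alternation Y) a) => aY; try lia.
  move=> X0 le E; have : ohead (word X) == ohead (word Y)
    by apply: contraLR isT; move: le; case: eqP => //= _; lia.
  have := word_nonzero nX.
  by case: (word X) (word Y) => [|x w] [|y v] //= _ /eqP[].
move=> _ _ E; have := card_palette_ge aX; have := card_palette_ge aY => bY bX.
suff -> : palette X = palette Y by [].
have eq_card : #|palette X| = #|palette Y| by lia.
by apply/eqP; rewrite eqEcard sub eq_card leqnn.
Qed.
End ColoredFibers.

(** * Stable sets in the fibres of a sign vector *)

Lemma subset_of_card (T : finType) (A : {set T}) k : k <= #|A| ->
  exists2 B : {set T}, B \subset A & #|B| = k.
Proof.
case/card_geqP=> s [us <- sA]; exists [set x in s].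
  by apply/subsetP => x; rewrite inE => /sA.
by rewrite cardsE; apply/card_uniqP.
Qed.

Definition path_stable n (S : {set 'I_n}) : bool :=
  [forall i in S, forall j in S, (i < j) ==> (i.+1 < j)].

Lemma path_stableP n (S : {set 'I_n}) :
  reflect {in S &, forall i j : 'I_n, i < j -> i.+1 < j} (path_stable S).
Proof.
apply: (iffP forall_inP) => [H i j iS jS ij|H i iS].
  exact: (implyP (forall_inP (H i iS) j jS)).
by apply/forall_inP => j jS; apply/implyP; apply: H.
Qed.

Lemma two_stableP n (S : {set 'I_n}) :
  reflect {in S &, forall i j : 'I_n, i < j -> i.+1 < j /\ j - i <= n - 2} (two_stable S).
Proof.
apply: (iffP forall_inP) => [H i j iS jS ij|H i iS].
  have := implyP (forall_inP (H i iS) j jS).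
  by rewrite -val_eqE /=; lia.
apply/forall_inP => j jS; apply/implyP; rewrite -val_eqE /=.
have := H i j iS jS; have := H j i jS iS; lia.
Qed.

Lemma path_stable_sub n (A B : {set 'I_n}) : B \subset A -> path_stable A -> path_stable B.
Proof.
move=> /subsetP BA /path_stableP H; apply/path_stableP => i j iB jB.
by apply: H; apply: BA.
Qed.

Lemma two_stable_sub n (A B : {set 'I_n}) : B \subset A -> two_stable A -> two_stable B.
Proof.
move=> /subsetP BA /two_stableP H; apply/two_stableP => i j iB jB.
by apply: H; apply: BA.
Qed.

Section Gaps.
Variables (n : nat) (T : eqType) (X : 'I_n -> T).
Notation increasing := (fun i j : 'I_n => i < j).
Notation changing := (fun i j : 'I_n => X i != X j).

Lemma increasing_trans : transitive increasing.
Proof. by move=> j i k; apply: ltn_trans. Qed.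

(** Consecutive positions would be neighbours in [b]. *)
Lemma alternating_gap b : sorted increasing b -> sorted changing b ->
  {in b &, forall i j : 'I_n, X i = X j -> i < j -> i.+1 < j}.
Proof.
elim: b => // x b IHb sb cb i j.
have sb' : sorted increasing b by apply: path_sorted sb.
have cb' : sorted changing b by apply: path_sorted cb.
have xb : all (increasing x) b by apply: order_path_min sb; apply: increasing_trans.
rewrite !inE => /predU1P[->|ib] /predU1P[->|jb] Xij ij.
- by rewrite ltnn in ij.
- case: b sb cb xb jb {IHb sb' cb'} => //= y b /andP[xy yb] /andP[cxy _] _.
  have ylt : all (increasing y) b by apply: order_path_min yb; apply: increasing_trans.
  rewrite inE => /predU1P[jy|/(allP ylt) /= ?]; last by lia.
  by rewrite -jy -Xij eqxx in cxy.
- by have := allP xb i ib => /=; lia.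
exact: IHb.
Qed.

Lemma sorted_extremes x b j : path increasing x b -> j \in x :: b ->
  x <= j <= last x b.
Proof.
elim: b x j => [|y b IHb] x j /=; first by rewrite inE => _ /eqP->; rewrite leqnn.
case/andP=> xy yb; rewrite inE => /predU1P[->|/(IHb _ _ yb)]; last by lia.
by have := IHb y y yb (mem_head y b); lia.
Qed.
End Gaps.

Section AlternatingPositions.
Variables (p n : nat) (X : signvec p n).

Definition sign_at i : 'F_p := odflt 0%R (X i).

Lemma alternating_positions : exists b : seq 'I_n,
  [/\ size b = alternation X, sorted (fun i j : 'I_n => i < j) b,
      {in b, forall i, X i = Some (sign_at i)} &
      sorted (fun i j => sign_at i != sign_at j) b].
Proof.
have [b [sub sz Xb alt _]] := alternating_subseq X (enum 'I_n).
have XE : {in b, forall i, X i = Some (sign_at i)}.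
  by move=> i /(allP Xb); rewrite /sign_at; case: (X i).
exists b; split=> //.
  apply: subseq_sorted sub _; first exact: increasing_trans.
  by have := iota_ltn_sorted 0 n; rewrite -val_enum_ord sorted_map.
apply: (@sub_in_sorted _ [in b] _ _ _ _ (allss b) alt) => i j ib jb.
by rewrite !XE //; apply: contra => /eqP->.
Qed.

Definition sign_class (b : seq 'I_n) s := [set i in b | sign_at i == s].

Lemma sign_class_fiber b s : {in b, forall i, X i = Some (sign_at i)} ->
  sign_class b s \subset fiber X s.
Proof.
by move=> XE; apply/subsetP => i; rewrite !inE => /andP[/XE-> /eqP->].
Qed.

Lemma sign_class_path_stable b s : sorted (fun i j : 'I_n => i < j) b ->
  sorted (fun i j => sign_at i != sign_at j) b -> path_stable (sign_class b s).
Proof.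
move=> sb cb; apply/path_stableP => i j; rewrite !inE => /andP[ib /eqP is_] /andP[jb /eqP js].
by apply: (alternating_gap sb cb); rewrite // is_ js.
Qed.

Lemma sum_sign_class b : uniq b -> \sum_s #|sign_class b s| = size b.
Proof.
move=> /card_uniqP <-; rewrite -sum1_card (partition_big sign_at predT) //=.
by apply: eq_bigr => s _; rewrite -sum1_card; apply: eq_bigl => i; rewrite !inE.
Qed.

Lemma increasing_uniq (b : seq 'I_n) : sorted (fun i j : 'I_n => i < j) b -> uniq b.
Proof. by apply: sorted_uniq => [|i]; [apply: increasing_trans | rewrite ltnn]. Qed.

(** Pigeonhole on the signs of an alternating sequence of positions. *)
Lemma path_stable_fiber k : prime p -> 0 < k -> p * (k - 1) < alternation X ->
  exists s, exists S : {set 'I_n}, [/\ path_stable S, #|S| = k & S \subset fiber X s].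
Proof.
move=> p_pr k0 ltX; have [b [sz sb XE cb]] := alternating_positions.
have [s ks] : exists s, k <= #|sign_class b s|.
  apply/existsP; rewrite -[[exists _, _]]negbK negb_exists; apply/negP => /forallP small.
  suff : size b <= p * (k - 1) by rewrite sz leqNgt ltX.
  rewrite -(sum_sign_class (increasing_uniq sb)) -[X in X * _](card_Fp p_pr) -sum_nat_const.
  by apply: leq_sum => s _; have := small s; lia.
have [S Ss Sk] := subset_of_card ks; exists s, S; split=> //.
  exact: path_stable_sub Ss (sign_class_path_stable _ sb cb).
exact: subset_trans Ss (sign_class_fiber _ XE).
Qed.
End AlternatingPositions.

Section TwoSigns.
Implicit Types (x y : 'F_2) (c : seq 'F_2).

Lemma F2_neq x y : (x != y) = (y == x + 1)%R.
Proof. by case: x y => [[|[|//]]] ? [[|[|//]]] ?. Qed.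

Lemma alternating_F2_last x c : path (fun u v => u != v) x c ->
  last x c = if odd (size c) then (x + 1)%R else x.
Proof.
elim: c x => [|y c IHc] x //= /andP[]; rewrite F2_neq => /eqP-> /IHc->.
by case: (odd _) => //=; case: x => [[|[|//]]] ?; apply: val_inj.
Qed.

Lemma alternating_F2_count k c s : sorted (fun u v => u != v) c -> size c = k.*2 ->
  count_mem s c = k.
Proof.
elim: k c => [|k IHk] [|x [|y c]] //= /andP[]; rewrite F2_neq => /eqP-> pc [sc].
rewrite (IHk c) ?(path_sorted pc) // addnA.
by rewrite -[RHS]add1n; congr (_ + _); case: s x {pc IHk} => [[|[|//]]] ? [[|[|//]]] ?.
Qed.
End TwoSigns.

(** Along exactly [2 * k] alternating positions each of the two signs occurs [k]
    times, and the extremes differ in sign, so that no class contains both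
    endpoints of the interval. *)
Lemma two_stable_fiber n k (X : signvec 2 n) s : 0 < k -> 2 * k <= alternation X ->
  exists S : {set 'I_n}, [/\ two_stable S, #|S| = k & S \subset fiber X s].
Proof.
move=> k0 leX; have [b0 [sz0 sb0 XE0 cb0]] := alternating_positions X.
(* An even length makes the two extremes differ in sign. *)
pose b := take (2 * k) b0.
have sb : sorted (fun i j : 'I_n => i < j) b by apply: take_sorted.
have cb : sorted (fun i j => sign_at X i != sign_at X j) b by apply: take_sorted.
have XE : {in b, forall i, X i = Some (sign_at X i)} by move=> i /mem_take; apply: XE0.
have sz : size b = k.*2 by rewrite -mul2n size_takel // sz0.
exists (sign_class X b s); split; last by apply: sign_class_fiber.
  apply/two_stableP => i j iS jS ij; split.
    by apply: (path_stableP _ (sign_class_path_stable s sb cb)).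
  have jn := ltn_ord j; suff : ~ (i = 0 :> nat /\ j.+1 = n) by lia.
  move=> [i0 jn1]; move: iS jS; rewrite !inE => /andP[ib /eqP is_] /andP[jb /eqP js].
  case: b sz sb cb XE ib jb => [|x b'] //= sz sb cb _ ib jb.
  have := sorted_extremes sb ib; have := sorted_extremes sb jb => /andP[_ jl] /andP[xi _].
  have xE : x = i by apply: val_inj => /=; lia.
  have lE : last x b' = j by apply: val_inj => /=; have := ltn_ord (last x b'); lia.
  have := @alternating_F2_last (sign_at X x) (map (sign_at X) b').
  rewrite path_map => /(_ cb); rewrite last_map lE xE is_ js size_map.
  have -> : size b' = (k.-1.*2).+1 by lia.
  by rewrite /= odd_double /=; case: (s) => [[|[|//]]] ?.
rewrite -(@alternating_F2_count k (map (sign_at X) b) s) ?size_map ?sorted_map //.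
rewrite count_map -size_filter -(card_uniqP (filter_uniq _ (increasing_uniq sb))).
by apply: eq_card => i; rewrite inE mem_filter andbC.
Qed.

(** * Monochromatic families of disjoint stable sets *)

(** Indexing by [nat] rather than by ['I_r] lets families be combined by
    Euclidean division. *)
Definition monochromatic_matching r n k (stab : pred {set 'I_n})
    (f : {set 'I_n} -> nat) (S : nat -> {set 'I_n}) :=
  (forall i, i < r -> [/\ stab (S i), #|S i| = k & f (S i) = f (S 0)]) /\
  (forall i j, i < r -> j < r -> i != j -> [disjoint S i & S j]).

(** Fewer than [(n - r * (k - 1)) / (r - 1)] colours are too few.  The condition
    [0 < t] is there for [two_stable]: for [r = k = 2] and [n = 3], no pair is
    cyclically stable, so that [t = 0] colours suffice. *)
Definition Kneser_bound r (stab : forall n, pred {set 'I_n}) :=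
  forall n k t (f : {set 'I_n} -> nat), 0 < k -> 0 < t ->
    r * (k - 1) + t * (r - 1) < n ->
    (forall S, stab n S -> #|S| = k -> f S < t) ->
    exists S, monochromatic_matching r k (stab n) f S.

Definition hereditary (stab : forall n, pred {set 'I_n}) :=
  forall n (A B : {set 'I_n}), B \subset A -> stab n A -> stab n B.

Definition unrestricted n : pred {set 'I_n} := predT.

Lemma full_color p n t a b (P : pred {set 'I_n}) (f : {set 'I_n} -> nat) :
  prime p -> (forall S, P S -> f S < t) -> 0 < b ->
  (forall X : signvec p n, a < alternation X ->
     b <= #|[set s | [exists S, P S && (S \subset fiber X s)]]|) ->
  a + (t * (p - 1) + 1 - b) < n ->
  exists (X : signvec p n) c, forall s, exists S,
    [/\ P S, S \subset fiber X s & f S = c].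
Proof.
move=> p_pr f_lt b0 many n_gt.
case: (boolP [exists X : signvec p n, [exists c : 'I_t, full P f X c]]).
  case/existsP=> X /existsP[c /eqP/setP fullc]; exists X, c => s.
  have := fullc s; rewrite in_slice !inE => /existsP[S /and3P[PS SX /eqP fS]].
  by exists S.
move=> /existsPn none; exfalso.
apply: (no_full_absurd p_pr f_lt b0 many n_gt) => X c.
by have /existsPn := none X; apply.
Qed.

Lemma fiber_disjoint p n (X : signvec p n) s u (A B : {set 'I_n}) : s != u ->
  A \subset fiber X s -> B \subset fiber X u -> [disjoint A & B].
Proof.
move=> su AX BX; apply: disjointWl AX _; apply: disjointWr BX _.
rewrite disjoint_subset; apply/subsetP => i; rewrite !inE => /eqP->.
by apply: contra su => /eqP[->].
Qed.

Lemma monochromatic_of_fibers p n k (stab : pred {set 'I_n}) f (X : signvec p n) c :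
  prime p ->
  (forall s, exists S, [/\ stab S && (#|S| == k), S \subset fiber X s & f S = c]) ->
  exists S, monochromatic_matching p k stab f S.
Proof.
move=> p_pr /(@fin_all_exists 'F_p)[g gP]; exists (fun i => g i%:R%R); split.
  move=> i _; have [/andP[st /eqP sz] _ ->] := gP i%:R%R.
  by have [_ _ ->] := gP 0%:R%R.
move=> i j ip jp ij; have [_ Xi _] := gP i%:R%R; have [_ Xj _] := gP j%:R%R.
apply: fiber_disjoint Xi Xj; apply: contra ij => /eqP/(congr1 val).
by rewrite /= !val_Fp_nat // !modn_small // => ->.
Qed.

Lemma Kneser_bound_prime p : prime p -> Kneser_bound p path_stable.
Proof.
move=> p_pr n k t f k0 t0 n_gt f_lt.
have p1 := prime_gt1 p_pr.
have [||||X [c Xc]] := @full_color p n t (p * (k - 1)) 1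
  [pred S : {set 'I_n} | path_stable S && (#|S| == k)] f p_pr; last first.
- exact: monochromatic_of_fibers Xc.
- by rewrite addnK.
- move=> X /(path_stable_fiber p_pr k0)[s [S [st sz SX]]].
  rewrite card_gt0; apply/set0Pn; exists s; rewrite inE; apply/existsP; exists S.
  by rewrite /= st sz eqxx.
- by [].
by move=> S /andP[st /eqP]; apply: f_lt.
Qed.

(** Any sign vector with [2 * k] runs already has a pair for each sign in its
    palette, which makes the threshold [2 * k - 1] as good as
    [2 * (k - 1)] with one pair. *)
Lemma Kneser_bound_two_stable : Kneser_bound 2 two_stable.
Proof.
move=> n k t f k0 t0 n_gt f_lt.
have [||||X [c Xc]] := @full_color 2 n t (2 * k - 1) 2
  [pred S : {set 'I_n} | two_stable S && (#|S| == k)] f isT; last first.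
- exact: monochromatic_of_fibers Xc.
- by lia.
- move=> X aX; rewrite (_ : [set s | _] = setT) ?cardsT ?card_ord //.
  apply/setP => s; rewrite !inE; apply/existsP.
  have [|S [st sz SX]] := two_stable_fiber s k0 (X := X); first by lia.
  by exists S; rewrite /= st sz eqxx.
- by [].
by move=> S /andP[st /eqP]; apply: f_lt.
Qed.

Lemma Kneser_bound1 : Kneser_bound 1 unrestricted.
Proof.
move=> n k t f k0 t0 n_gt f_lt; have [|S _ Sk] := @subset_of_card 'I_n setT k.
  by rewrite cardsT card_ord; lia.
by exists (fun=> S); split=> // i j; case: i j => [|i] [|j].
Qed.

Lemma Kneser_bound_sub r (stab stab' : forall n, pred {set 'I_n}) :
  (forall n S, stab n S -> stab' n S) -> Kneser_bound r stab -> Kneser_bound r stab'.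
Proof.
move=> sub H n k t f k0 t0 n_gt f_lt.
have [|S [S1 S2]] := H n k t f k0 t0 n_gt; first by move=> S /sub; apply: f_lt.
by exists S; split=> // i /S1[/sub].
Qed.

Lemma matching_within r n k t (A : {set 'I_n}) (f : {set 'I_n} -> nat) :
  Kneser_bound r unrestricted -> 0 < k -> 0 < t ->
  r * (k - 1) + t * (r - 1) < #|A| ->
  (forall S : {set 'I_n}, S \subset A -> #|S| = k -> f S < t) ->
  exists S, monochromatic_matching r k [pred S : {set 'I_n} | S \subset A] f S.
Proof.
move=> H k0 t0 ltA f_lt.
pose h : 'I_#|A| -> 'I_n := enum_val.
have hI : injective h := enum_val_inj.
have hA (B : {set 'I_#|A|}) : h @: B \subset A.
  by apply/subsetP => _ /imsetP[i _ ->]; apply: enum_valP.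
have [|S [S1 S2]] := H #|A| k t (fun B => f (h @: B)) k0 t0 ltA.
  by move=> B _ Bk; apply: f_lt; rewrite ?hA // card_imset.
exists (fun i => h @: S i); split=> [i /S1[_ sz ?]|i j ir jr ij].
  by split; rewrite ?inE ?hA // card_imset.
by rewrite imset_disjoint //; apply: S2.
Qed.

(** A stable set of a suitable size is coloured by the colour of [r1] disjoint
    [k]-subsets of it; these are stable too. *)
Lemma Kneser_bound_mul r1 r2 stab : hereditary stab -> 0 < r1 -> 0 < r2 ->
  Kneser_bound r2 stab -> Kneser_bound r1 unrestricted -> Kneser_bound (r2 * r1) stab.
Proof.
move=> her r1_gt0 r2_gt0 H2 H1 n k t f k0 t0 n_gt f_lt.
(* The least size at which [r1] disjoint [k]-subsets of one colour exist. *)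
pose m := (r1 * (k - 1) + t * (r1 - 1)).+1.
have inner (A : {set 'I_n}) : exists S : nat -> {set 'I_n},
    stab n A -> #|A| = m -> monochromatic_matching r1 k [pred S : {set 'I_n} | S \subset A] f S.
  have [stA|nstA] := boolP (stab n A); last by exists (fun=> set0).
  have [Am|nAm] := eqVneq #|A| m; last by exists (fun=> set0) => _ /eqP; rewrite (negPf nAm).
  have [||S HS] := @matching_within r1 n k t A f H1 k0 t0; last by exists S.
    by rewrite Am.
  by move=> S SA; apply: f_lt; apply: her SA stA.
have [S HS] := fin_all_exists inner.
have [||A [A1 A2]] := @H2 n m t (fun A => f (S A 0)) isT t0.
- rewrite /m subn1 /=; case: (r1) (r2) r1_gt0 r2_gt0 n_gt => // a [] // b _ _; nia.
- move=> A stA /(HS A stA)[/(_ 0 r1_gt0) [SA Sk _] _].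
  by apply: f_lt => //; apply: her SA stA.
have inA j : j < r2 -> monochromatic_matching r1 k [pred S : {set 'I_n} | S \subset A j] f (S (A j)).
  by case/A1=> st sz _; apply: HS.
have dv i : i < r2 * r1 -> i %/ r1 < r2 /\ i %% r1 < r1.
  by move=> ir; rewrite ltn_divLR // ltn_pmod.
exists (fun i => S (A (i %/ r1)) (i %% r1)); split=> [i ir|i j ir jr ij].
  have [i2 i1] := dv i ir; have [/(_ _ i1) [sub sz e1] _] := inA _ i2.
  have [st _ e2] := A1 _ i2.
  by split=> //; [apply: her sub st | rewrite e1 e2 div0n mod0n].
have [i2 i1] := dv i ir; have [j2 j1] := dv j jr.
have [Si Di] := inA _ i2; have [Sj Dj] := inA _ j2.
have [E|nE] := eqVneq (i %/ r1) (j %/ r1).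
  rewrite -E; apply: Di => //; apply: contra ij => /eqP Em.
  by rewrite (divn_eq i r1) (divn_eq j r1) E Em.
have [sub_i _ _] := Si _ i1; have [sub_j _ _] := Sj _ j1.
by apply: disjointWl sub_i _; apply: disjointWr sub_j _; apply: A2.
Qed.

Lemma Kneser_bound_unrestricted r : 0 < r -> Kneser_bound r unrestricted.
Proof.
elim/ltn_ind: r => r IHr r0.
have [r1|r1] := leqP r 1.
  by rewrite (_ : r = 1); [apply: Kneser_bound1 | lia].
have p_pr := pdiv_prime r1; have p1 := prime_gt1 p_pr.
rewrite -(divnK (pdiv_dvd r)) mulnC.
have q0 : 0 < r %/ pdiv r by rewrite divn_gt0 ?pdiv_gt0 // pdiv_leq.
apply: Kneser_bound_mul; rewrite ?pdiv_gt0 //.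
  exact: Kneser_bound_sub (Kneser_bound_prime p_pr).
by apply: IHr => //; apply: ltn_Pdiv.
Qed.

Lemma Kneser_bound_path_stable r : 1 < r -> Kneser_bound r path_stable.
Proof.
move=> r1; have p_pr := pdiv_prime r1.
rewrite -(divnK (pdiv_dvd r)) mulnC.
have q0 : 0 < r %/ pdiv r by rewrite divn_gt0 ?pdiv_gt0 // pdiv_leq // ltnW.
apply: Kneser_bound_mul; rewrite ?pdiv_gt0 //.
- by move=> n A B; apply: path_stable_sub.
- exact: Kneser_bound_prime.
exact: Kneser_bound_unrestricted.
Qed.

Lemma Kneser_bound_even r : 0 < r -> Kneser_bound (2 * r) two_stable.
Proof.
move=> r0; apply: Kneser_bound_mul => //.
- by move=> n A B; apply: two_stable_sub.
- exact: Kneser_bound_two_stable.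
exact: Kneser_bound_unrestricted.
Qed.

(** If [n <> k %[mod r - 1]], the inequality on [n] is strict enough to give up
    the last position, which opens the circle into a path. *)
Lemma two_stable_matching r n k t (f : {set 'I_n} -> nat) :
  0 < k -> 0 < t -> 1 < r -> r * (k - 1) + t * (r - 1) < n ->
  n <> k %[mod r - 1] \/ ~~ odd r ->
  (forall S, two_stable S -> #|S| = k -> f S < t) ->
  exists S, monochromatic_matching r k (@two_stable n) f S.
Proof.
move=> k0 t0 r1 n_gt [neq|ev] f_lt; last first.
  move: n_gt; have -> : r = 2 * r./2 by have := odd_double_half r; rewrite (negPf ev); lia.
  by move=> n_gt; apply: (Kneser_bound_even _ k0 t0) => //; lia.
case: n f n_gt neq f_lt => // n f n_gt neq f_lt.
have n_gt' : r * (k - 1) + t * (r - 1) < n.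
  rewrite ltn_neqAle -ltnS n_gt andbT; apply/eqP => E; apply: neq.
  have -> : n.+1 = ((k - 1) + t) * (r - 1) + k.
    by rewrite -E; case: (r) (k) r1 k0 => // a [] // b _ _; nia.
  by rewrite modnMDl.
pose h := widen_ord (leqnSn n).
have hI : injective h by move=> i j /(congr1 val) /= ij; apply: val_inj.
have hst (S : {set 'I_n}) : path_stable S -> two_stable (h @: S).
  move/path_stableP=> st; apply/two_stableP => _ _ /imsetP[i iS ->] /imsetP[j jS ->] /= ij.
  by split; [apply: st | have := ltn_ord j; lia].
have [|S [S1 S2]] := Kneser_bound_path_stable r1 (f := fun S => f (h @: S)) k0 t0 n_gt'.
  by move=> S /hst st Sk; apply: f_lt; rewrite // card_imset.
exists (fun i => h @: S i); split=> [i /S1[/hst st sz ?]|i j ir jr ij].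
  by split; rewrite // card_imset.
by rewrite imset_disjoint //; apply: S2.
Qed.

(** A colouring without colours is treated as one with a single colour: the
    inequality to be refuted persists, because [r * k <= n]. *)
Lemma colorable_lower r n k c : 0 < k -> 1 < r -> r * k <= n ->
  n <> k %[mod r - 1] \/ ~~ odd r ->
  colorable (KG_edges r n k) c -> n <= r * (k - 1) + c * (r - 1).
Proof.
move=> k0 r1 n_ge nkr /existsP[f /forall_inP fP]; rewrite leqNgt; apply/negP => n_gt.
(* The value outside the vertices is arbitrary. *)
pose g S := if insub S is Some v then val (f (v : KG_vertex n k)) else 0.
have n_gt' : r * (k - 1) + maxn c 1 * (r - 1) < n.
  by case: c {f fP g} n_gt => [|c] n_gt; [| by rewrite (maxn_idPl _)]; rewrite max0n mul1n; nia.
have gE (v : KG_vertex n k) : g (val v) = f v by rewrite /g valK.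
have t0 : 0 < maxn c 1 by rewrite leq_max orbT.
have [|S [S1 S2]] := two_stable_matching (f := g) k0 t0 r1 n_gt' nkr.
  move=> S st /eqP Sk.
  have -> : S = val (Sub S (introT andP (conj st Sk)) : KG_vertex n k) by [].
  by rewrite gE leq_max ltn_ord.
have [v vS] : exists v : 'I_r -> KG_vertex n k, forall i, val (v i) = S i.
  apply: (@fin_all_exists 'I_r _ (fun i v => val v = S i)) => i; have [st sz _] := S1 i (ltn_ord i).
  have Si : two_stable (S i) && (#|S i| == k) by rewrite st sz eqxx.
  by exists (Sub (S i) Si).
have dis i j : i != j -> [disjoint val (v i) & val (v j)].
  by move=> ij; rewrite !vS; apply: S2.
have vI : injective v.
  move=> i j vij; apply/eqP/idPn => /dis; rewrite vij -setI_eq0 setIid -cards_eq0.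
  by case/andP: (valP (v j)) => _ /eqP->; rewrite eqn0Ngt k0.
have /fP/negP[] : [set v i | i in 'I_r] \in KG_edges r n k.
  rewrite inE card_imset // card_ord eqxx /=.
  apply/forall_inP => _ /imsetP[i _ ->]; apply/forall_inP => _ /imsetP[j _ ->].
  by rewrite (inj_eq vI); apply/implyP; apply: dis.
apply/forall_inP => _ /imsetP[i _ ->]; apply/forall_inP => _ /imsetP[j _ ->].
rewrite -val_eqE /= -!gE !vS.
by have [_ _ ->] := S1 i (ltn_ord i); have [_ _ ->] := S1 j (ltn_ord j).
Qed.

(** * The chromatic number *)

Lemma card_ord_geq n m (A : {set 'I_n}) : (forall i, i \in A -> m <= i) -> #|A| <= n - m.
Proof.
move=> mA; rewrite cardE -(size_map val) -(size_iota m (n - m)).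
apply: uniq_leq_size => [|_ /mapP[i iA ->]].
  by rewrite map_inj_uniq ?enum_uniq //; apply: val_inj.
by rewrite mem_enum in iA; have := mA i iA; have := ltn_ord i; rewrite mem_iota /=; lia.
Qed.

Lemma colorable_upper r n k c : 0 < k -> 1 < r -> r * k <= n ->
  n <= r * (k - 1) + c * (r - 1) -> colorable (KG_edges r n k) c.
Proof.
move=> k0 r1 n_ge; case: c => [|c] n_le.
  by case: k k0 n_ge n_le => // k _; nia.
have [mn mnP] : exists mn : KG_vertex n k -> 'I_n, forall v,
    mn v \in val v /\ forall i, i \in val v -> mn v <= i.
  apply: (@fin_all_exists _ _ (fun (v : KG_vertex n k) (i : 'I_n) =>
    i \in val v /\ forall j, j \in val v -> i <= j)) => v.
  have /card_gt0P[i0 i0v] : 0 < #|val v| by case/andP: (valP v) => _ /eqP->.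
  by case: (arg_minnP (fun i : 'I_n => val i) i0v) => i iv imin; exists i.
apply/existsP; exists [ffun v => inord (minn (mn v %/ (r - 1)) c)].
apply/forall_inP => e; rewrite inE => /andP[/eqP er /forall_inP edis].
have dis u v : u \in e -> v \in e -> u != v -> [disjoint val u & val v].
  by move=> ue ve; apply/implyP; move: v ve; apply/forall_inP/edis.
have mnI : {in e &, injective mn}.
  move=> u v ue ve uv; apply/eqP/idPn => /(dis u v ue ve)/disjointFr/(_ (proj1 (mnP u))).
  by rewrite uv (proj1 (mnP v)).
apply/negP => /forall_inP mono.
have /card_gt0P[v0 v0e] : 0 < #|e| by rewrite er; lia.
have sameE v : v \in e -> minn (mn v %/ (r - 1)) c = minn (mn v0 %/ (r - 1)) c.
  move=> ve; have /eqP := forall_inP (mono v ve) v0 v0e.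
  by rewrite !ffunE => /(congr1 val); rewrite /= !inordK // ltnS geq_minr.
have r0 : 0 < r - 1 by lia.
have [lt0|ge0] := ltnP (mn v0 %/ (r - 1)) c.
  have same v : v \in e -> mn v %/ (r - 1) = mn v0 %/ (r - 1).
    by move=> /sameE; lia.
  (* Distinct minima with one quotient have distinct remainders. *)
  suff : #|e| <= #|'I_(r - 1)| by rewrite er card_ord; lia.
  pose h v := Ordinal (ltn_pmod (mn v) r0).
  rewrite -(card_in_imset (f := h)) ?max_card // => u v ue ve /(congr1 val) /= uv.
  apply: mnI => //; apply: val_inj => /=.
  by rewrite (divn_eq (mn u) (r - 1)) uv same // -(same v) // -divn_eq.
have big v : v \in e -> forall i, i \in val v -> c * (r - 1) <= i.
  move=> ve i iv; apply: leq_trans (proj2 (mnP v) i iv).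
  by rewrite -leq_divRL //; have := sameE v ve; lia.
(* In the last colour, [r * k] positions from [c * (r - 1)] on are occupied. *)
pose P := [set val v | v in e].
have trP : trivIset P.
  apply/trivIsetP => _ _ /imsetP[u ue ->] /imsetP[v ve ->] uv.
  by apply: dis => //; apply: contra uv => /eqP->.
have cP : #|cover P| = r * k.
  rewrite -(eqP trP) (eq_bigr (fun=> k)) => [|_ /imsetP[v ve ->]].
    by rewrite sum_nat_const card_imset ?er //; apply: val_inj.
  by case/andP: (valP v) => _ /eqP.
have := @card_ord_geq n (c * (r - 1)) (cover P); rewrite cP => H.
have {H} : r * k <= n - c * (r - 1).
  by apply: H => i /bigcupP[_ /imsetP[v ve ->]]; apply: big.
by case: (k) k0 n_le => // k' _; nia.
Qed.

Theorem theorem4 (k n r : nat) (k_gt0 : 0 < k) (n_gt0 : 0 < n) (r_ge2 : 2 <= r)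
    (n_ge_rk : r * k <= n)
    (n_k_r : n <> k %[mod r - 1] \/ ~~ odd r) :
  Posz (chromatic_number (KG_edges r n k))
    = Num.ceil ((n%:Q - r%:Q * (k%:Q - 1)) / (r%:Q - 1))%R.
Proof.
have [colX minX] := chromatic_numberP (KG_edges_card_gt1 (n := n) (k := k) r_ge2).
move: (chromatic_number _) colX minX => c colX minX.
have lower := colorable_lower k_gt0 r_ge2 n_ge_rk n_k_r colX.
have upper : r * (k - 1) + (c - 1) * (r - 1) < n.
  rewrite ltnNge; apply/negP => n_le.
  have := minX _ (colorable_upper k_gt0 r_ge2 n_ge_rk n_le).
  by case: c lower {n_le colX minX} => [|c] lower; [nia | lia].
have c_gt0 : 0 < c by case: c lower {colX minX upper} => // lower; nia.
symmetry; apply: ceil_def.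
case: k k_gt0 lower upper {n_ge_rk n_k_r colX minX} => // k _.
case: r r_ge2 => [|[|r]] // _; case: c c_gt0 => // c _; rewrite !subn1 /= => lower upper.
have r_pos : (0 < r.+1%:R :> rat)%R by rewrite ltr0n.
have -> : (r.+2%:Q - 1 = r.+1%:R :> rat)%R by rewrite -[r.+2]addn1 PoszD rmorphD /= addrK.
have -> : (n%:Q - r.+2%:Q * (k.+1%:Q - 1) = n%:R - (r.+2 * k)%:R :> rat)%R.
  by rewrite -[k.+1]addn1 PoszD rmorphD /= addrK natrM.
rewrite ler_pdivrMr // ltr_pdivlMr // -pmulrn.
have -> : ((c.+1%:Z - 1)%:~R = c%:R :> rat)%R by rewrite -[c.+1]addn1 PoszD addrK.
by rewrite ltrBrDr lerBlDr -!natrM -!natrD ltr_nat ler_nat addnC upper addnC.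
Qed.
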